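(* For any infinite regular ($T_1$) space $X$, the following are equivalent. (i) $X$ is countable. (ii) $MU_p(X)$ is metrizable. (iii) $MU_p(X)$ is not discretely selective. (iv) $\mathrm{II} \underset{\mathrm{mark}}{\uparrow} \mathsf G_1(\Omega_X,\Omega_X)$. (v) $\mathrm{II} \underset{\mathrm{mark}}{\uparrow} \mathsf G_1(\Omega_{MU_p(X),\mathbf 0},\Omega_{MU_p(X),\mathbf 0})$. (vi) $\mathrm{II} \underset{\mathrm{mark}}{\uparrow} \mathsf G_1(\mathscr D_{MU_p(X)},\Omega_{MU_p(X),\mathbf 0})$. Also, for any non-compact regular ($T_1$) space $X$, the following are equivalent. (i) $X$ is hemicompact. (ii) $\mathbb K(X)$ is hemicompact. (iii) $MU_k(X)$ is metrizable. (iv) $MU_k(X)$ is not discretely selective. (v) $\mathrm{II} \underset{\mathrm{mark}}{\uparrow} \mathsf G_1(\mathcal K_X,\mathcal K_X)$. (vi) $\mathrm{II} \underset{\mathrm{mark}}{\uparrow} \mathsf G_1(\Omega_{MU_k(X),\mathbf 0},\Omega_{MU_k(X),\mathbf 0})$. (vii) $\mathrm{II} \underset{\mathrm{mark}}{\uparrow} \mathsf G_1(\mathscr D_{MU_k(X)},\Omega_{MU_k(X),\mathbf 0})$.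
   Context: Games. For collections $\mathcal P,\mathcal Q$ of sets, in the game $\mathsf G_1(\mathcal P,\mathcal Q)$, at round $n\in\omega$ One chooses $P_n\in\mathcal P$ and Two responds with $x_n\in P_n$; Two wins if $\{x_n:n\in\omega\}\in\mathcal Q$, otherwise One wins. A Markov strategy for Two is a function $\tau:\mathcal P\times\omega\to\bigcup\mathcal P$ with $\tau(P,n)\in P$ (it depends only on One's latest move and the round number); it is winning if $\{\tau(P_n,n):n\in\omega\}\in\mathcal Q$ for every $(P_n)\in\mathcal P^\omega$. $\mathrm{II}\underset{\mathrm{mark}}{\uparrow}\mathsf G_1(\mathcal P,\mathcal Q)$ means Two has a winning Markov strategy. Covers. $K(X)$ is the set of non-empty compact subsets of $X$; $\mathbb K(X)$ is $K(X)$ with the Vietoris topology. An open cover $\mathscr U$ of $X$ is non-trivial if $\emptyset,X\notin\mathscr U$. $\Omega_X$ is the set of $\omega$-covers: non-trivial open covers $\mathscr U$ such that each non-empty finite subset of $X$ is contained in some $U\in\mathscr U$. $\mathcal K_X$ is the set of $k$-covers: non-trivial open covers $\mathscr U$ such that each non-empty compact subset of $X$ is contained in some $U\in\mathscr U$. A space is hemicompact if it has countably many compact subsets such that every compact subset is contained in one of them. For a space $Z$, $\mathscr D_Z$ is the set of dense subsets of $Z$, and $\Omega_{Z,z}=\{S\subseteq Z: z\in\mathrm{cl}(S)\}$. $Z$ is discretely selective if for every sequence $(O_n)_{n\in\omega}$ of proper non-empty open subsets of $Z$ there are $z_n\in O_n$ such that $\{z_n:n\in\omega\}$ is a closed discrete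 subset of $Z$. Minimal usco maps. An usco map $\Phi$ from $X$ to $\mathbb R$ assigns to each $x\in X$ a non-empty compact set $\Phi(x)\subseteq\mathbb R$ so that $\{x:\Phi(x)\subseteq V\}$ is open for every open $V\subseteq\mathbb R$; it is minimal if its graph $\{(x,y):y\in\Phi(x)\}$ is $\subseteq$-minimal among graphs of usco maps from $X$ to $\mathbb R$. $MU(X)$ is the set of minimal usco maps from $X$ to $\mathbb R$. For $\Phi\in MU(X)$, $A\subseteq X$, $\varepsilon>0$, $[\Phi;A,\varepsilon]$ is the set of $\Psi\in MU(X)$ such that for all $x\in A$ each point of $\Phi(x)$ is within distance $<\varepsilon$ of some point of $\Psi(x)$ and each point of $\Psi(x)$ is within distance $<\varepsilon$ of some point of $\Phi(x)$. $MU_p(X)$ (resp. $MU_k(X)$) is $MU(X)$ with the topology in which $O$ is open iff for each $\Phi\in O$ there are a non-empty finite (resp. compact) $A\subseteq X$ and $\varepsilon>0$ with $[\Phi;A,\varepsilon]\subseteq O$. $\mathbf 0\in MU(X)$ is the constant map $x\mapsto\{0\}$. *)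

(* Defs.v *)
From HB Require Import structures.
From mathcomp Require Import all_boot all_order all_algebra.
From mathcomp Require Import all_classical all_reals all_analysis.

Set Implicit Arguments.
Unset Strict Implicit.
Unset Printing Implicit Defensive.

Import Order.TTheory GRing.Theory Num.Theory.
Import numFieldNormedType.Exports.

Local Open Scope classical_set_scope.
Local Open Scope ring_scope.

(* The single selection game G_1(P, Q) on a ground type T: P and Q are
   collections of subsets of T. A strategy is a total function on [set T], but
   only its values on members of P are constrained or used. *)
Definition markov_strategy (T : Type) (P : set (set T))
    (tau : set T -> nat -> T) : Prop :=
  forall (A : set T) (n : nat), P A -> A (tau A n).

Definition winning_markov_strategy (T : Type) (P Q : set (set T))
    (tau : set T -> nat -> T) : Prop :=
  markov_strategy P tau /\
  forall A : nat -> set T, (forall n, P (A n)) ->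
    Q (range (fun n => tau (A n) n)).

Definition II_mark_G1 (T : Type) (P Q : set (set T)) : Prop :=
  exists tau : set T -> nat -> T, winning_markov_strategy P Q tau.

Definition nontrivial_open_cover (X : topologicalType) (U : set (set X)) : Prop :=
  [/\ forall V, U V -> open V, \bigcup_(V in U) V = [set: X],
      ~ U set0 & ~ U [set: X]].

Definition omega_covers (X : topologicalType) : set (set (set X)) :=
  [set U | nontrivial_open_cover U /\
    forall F : set X, finite_set F -> F !=set0 -> exists2 V, U V & F `<=` V].

Definition k_covers (X : topologicalType) : set (set (set X)) :=
  [set U | nontrivial_open_cover U /\
    forall K : set X, compact K -> K !=set0 -> exists2 V, U V & K `<=` V].

Definition dense_sets (Z : topologicalType) : set (set Z) :=
  [set S | dense S].

Definition clusters_at (Z : topologicalType) (z : Z) : set (set Z) :=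
  [set S | closure S z].

Definition hemicompact (X : topologicalType) : Prop :=
  exists F : set (set X),
    [/\ countable F, forall K, F K -> compact K &
        forall C : set X, compact C -> exists2 K, F K & C `<=` K].

Definition closed_discrete (Z : topologicalType) (D : set Z) : Prop :=
  closed D /\ D `<=` isolated D.

Definition discretely_selective (Z : topologicalType) : Prop :=
  forall O : nat -> set Z,
    (forall n, [/\ open (O n), O n !=set0 & O n != [set: Z]]) ->
    exists z : nat -> Z, (forall n, O n (z n)) /\ closed_discrete (range z).

Definition metrizable (R : realType) (Z : topologicalType) : Prop :=
  exists d : Z -> Z -> R,
    [/\ forall x y, d x y = 0 <-> x = y,
        forall x y, d x y = d y x,
        forall x y z, d x z <= d x y + d y z &
        forall O : set Z, open O <->
          forall x, O x -> exists2 e, 0 < e & [set y | d x y < e] `<=` O].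

Record hyperspace (X : topologicalType) := Hyperspace {
  hyper_set :> set X;
  hyper_compact : compact hyper_set;
  hyper_neq0 : hyper_set !=set0
}.

HB.instance Definition _ (X : topologicalType) := gen_eqMixin (hyperspace X).
HB.instance Definition _ (X : topologicalType) :=
  gen_choiceMixin (hyperspace X).

Definition vietoris_subbase (X : topologicalType) : set (set (hyperspace X)) :=
  [set B | exists2 U : set X, open U &
     B = [set K : hyperspace X | K `<=` U] \/
     B = [set K : hyperspace X | K `&` U !=set0]].

HB.instance Definition _ (X : topologicalType) :=
  isSubBaseTopological.Build (hyperspace X) (@vietoris_subbase X) id.

Section MinimalUsco.
Variables (R : realType) (X : topologicalType).

Definition usco (F : X -> set R) : Prop :=
  (forall x, F x !=set0 /\ compact (F x)) /\
  (forall V : set R, open V -> open [set x | F x `<=` V]).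

Definition set_graph (F : X -> set R) : set (X * R) := [set p | F p.1 p.2].

Definition minimal_usco (F : X -> set R) : Prop :=
  usco F /\
  forall G, usco G -> set_graph G `<=` set_graph F -> set_graph G = set_graph F.

Record MU := MkMU {
  MU_map :> X -> set R;
  MU_minimal : minimal_usco MU_map
}.

(* The basic set [Phi; A, e]. *)
Definition MU_ball (Phi : MU) (A : set X) (e : R) : set MU :=
  [set Psi : MU | forall x, A x ->
     (forall y, Phi x y -> exists2 z, Psi x z & `|y - z| < e) /\
     (forall z, Psi x z -> exists2 y, Phi x y & `|z - y| < e)].

(* The clause [O = setT] only matters when no member of [fam] exists, i.e. when
   X is empty for the two families used below; see MUp_openE and MUk_openE. *)
Definition MU_open (fam : set (set X)) : set (set MU) :=
  [set O | O = setT \/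
    forall Phi, O Phi -> exists (A : set X) (e : R),
      [/\ fam A, 0 < e & MU_ball Phi A e `<=` O]].

Definition nonempty_finite : set (set X) :=
  [set A | A !=set0 /\ finite_set A].

Definition nonempty_compact : set (set X) :=
  [set A | A !=set0 /\ compact A].

Lemma zero_minimal_usco : minimal_usco (fun=> [set 0]).
Proof.
split.
  split=> [x|V oV]; first by split; [exists 0|exact: compact_set1].
  have [V0|V0] := pselect (V 0).
    by rewrite (_ : [set _ | _] = setT); [exact: openT|
      apply/seteqP; split=> // x _ _ ->].
  by rewrite (_ : [set _ | _] = set0); [exact: open0|
    apply/seteqP; split=> // x /(_ 0 erefl)].
move=> G [G0 _] sub; apply/seteqP; split=> // -[x y].
have [[z Gz] _] := G0 x; have z0 : z = 0 := sub (x, z) Gz.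
by rewrite /set_graph/= => ->; rewrite -z0.
Qed.

Definition MU_zero : MU := MkMU zero_minimal_usco.

Lemma MU_ball_sub (Phi : MU) (A B : set X) (e f : R) :
  A `<=` B -> f <= e -> MU_ball Phi B f `<=` MU_ball Phi A e.
Proof.
move=> AB fe Psi h x /AB /h[h1 h2].
by split=> y => [/h1|/h2] [z ? lt]; exists z => //; exact: lt_le_trans fe.
Qed.

Lemma MU_openT (fam : set (set X)) : MU_open fam setT.
Proof. by left. Qed.

Lemma MU_openI (fam : set (set X)) : setU_closed fam ->
  setI_closed (MU_open fam).
Proof.
move=> famU O P [->|hO]; first by rewrite setTI.
move=> [->|hP]; first by rewrite setIT; right.
right=> Phi [/hO[A [e [fA e0 sA]]] /hP[B [f [fB f0 sB]]]].
exists (A `|` B), (Num.min e f); split; first exact: famU.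
- by rewrite lt_min e0.
- move=> Psi h; split; [apply: sA|apply: sB]; move: Psi h.
  + by apply: MU_ball_sub; [exact: subsetUl|rewrite ge_min lexx].
  + by apply: MU_ball_sub; [exact: subsetUr|rewrite ge_min lexx orbT].
Qed.

Lemma MU_open_bigU (fam : set (set X)) (I : Type) (f : I -> set MU) :
  (forall i, MU_open fam (f i)) -> MU_open fam (\bigcup_i f i).
Proof.
move=> h; have [[i fi]|nT] := pselect (exists i, f i = setT).
  by left; apply/seteqP; split=> // Phi _; exists i => //; rewrite fi.
right=> Phi [i _ fiPhi].
have [fT|/(_ _ fiPhi)[A [e [fA e0 s]]]] := h i; first by case: nT; exists i.
by exists A, e; split=> // Psi /s; exists i.
Qed.

Lemma MU_openE (fam : set (set X)) (O : set MU) : fam !=set0 ->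
  MU_open fam O <->
  forall Phi, O Phi -> exists (A : set X) (e : R),
    [/\ fam A, 0 < e & MU_ball Phi A e `<=` O].
Proof.
move=> [A fA]; split=> [[->|//]|]; last by right.
by move=> Phi _; exists A, 1; split.
Qed.

Lemma nonempty_finiteU : setU_closed nonempty_finite.
Proof.
move=> A B [[x Ax] fA] [_ fB]; split; first by exists x; left.
by rewrite finite_setU.
Qed.

Lemma nonempty_compactU : setU_closed nonempty_compact.
Proof.
move=> A B [[x Ax] fA] [_ fB]; split; first by exists x; left.
exact: compactU.
Qed.

Definition MUp : Type := MU.
Definition MUk : Type := MU.

HB.instance Definition _ := gen_eqMixin MUp.
HB.instance Definition _ := gen_choiceMixin MUp.
HB.instance Definition _ := isOpenTopological.Build MUp
  (@MU_openT nonempty_finite) (MU_openI nonempty_finiteU)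
  (@MU_open_bigU nonempty_finite).

HB.instance Definition _ := gen_eqMixin MUk.
HB.instance Definition _ := gen_choiceMixin MUk.
HB.instance Definition _ := isOpenTopological.Build MUk
  (@MU_openT nonempty_compact) (MU_openI nonempty_compactU)
  (@MU_open_bigU nonempty_compact).

Definition MUp_zero : MUp := MU_zero.
Definition MUk_zero : MUk := MU_zero.

Lemma MUp_openE (O : set MUp) : [set: X] !=set0 ->
  open O <->
  forall Phi : MUp, O Phi -> exists (A : set X) (e : R),
    [/\ A !=set0 /\ finite_set A, 0 < e & MU_ball Phi A e `<=` O].
Proof.
move=> [x _]; apply: (@MU_openE nonempty_finite).
by exists [set x]; split; [exists x|exact: finite_set1].
Qed.

Lemma MUk_openE (O : set MUk) : [set: X] !=set0 ->
  open O <->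
  forall Phi : MUk, O Phi -> exists (A : set X) (e : R),
    [/\ A !=set0 /\ compact A, 0 < e & MU_ball Phi A e `<=` O].
Proof.
move=> [x _]; apply: (@MU_openE nonempty_compact).
by exists [set x]; split; [exists x|exact: compact_set1].
Qed.

End MinimalUsco.

Arguments omega_covers : clear implicits.
Arguments k_covers : clear implicits.
Arguments dense_sets : clear implicits.
Arguments MUp_zero : clear implicits.
Arguments MUk_zero : clear implicits.

(* Main.v *)
Require Import Defs.
From HB Require Import structures.
From mathcomp Require Import all_boot all_order all_algebra.
From mathcomp Require Import all_classical all_reals all_analysis.
From mathcomp Require Import lra.

Set Implicit Arguments.
Unset Strict Implicit.
Unset Printing Implicit Defensive.

Import Order.TTheory GRing.Theory Num.Theory.
Import numFieldNormedType.Exports.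

Local Open Scope classical_set_scope.
Local Open Scope ring_scope.

(** Both lists of equivalences are one statement about a family [fam] of
compact sets that is closed under unions and contains the points: the finite
sets for the first list, the compact sets for the second.  Every item is
equivalent to [countably_cofinal fam]: some sequence [A n] of members of [fam]
absorbs every member.  For the finite sets this says that [X] is countable, for
the compact sets that [X] is hemicompact.

If such a sequence exists, [MU] with the topology of uniform convergence on
[fam] has countable neighbourhood bases, uniformly in the point, and is
metrizable ([cofinal_metrizable]); a metrizable space with a non-isolated point
is not discretely selective, because one can select from punctured balls that
shrink to that point; and Two wins the selection games by taking care of [A n]
at round [n] ([cofinal_mark_covers], [cofinal_mark_clusters]).

Conversely, suppose that no sequence in [fam] is cofinal.  Then for every
sequence [A n] in [fam] there are a single [B] in [fam] and points [x n] of [B]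
outside [A n] ([not_cofinal_escape]).  A minimal usco map can be given any
value at [x n] without changing it on [A n] ([MU_modify]); this is where
regularity and Zorn's lemma enter.
- Given open sets containing neighbourhoods [Phi n; A n, e n], modify [Phi n] to
  have value [n] at [x n].  A minimal usco map is bounded on [B], so the
  modified maps leave every point's neighbourhood: they form a closed discrete
  set, and [MU] is discretely selective.
- A Markov strategy of Two is, round by round, a choice function, and the set of
  its values at one round meets every legal move of One.  For dense sets these
  values therefore contain some [Phi n; A n, e n], and One can force the value 1
  at [x n], so that zero is not in the closure.  For covers they contain all
  proper open supersets of some [A n], and One can force the complement of
  [x n], so that [B] is not covered ([mark_dense_cofinal],
  [mark_covers_cofinal]).

Hemicompactness passes between [X] and its hyperspace because the union of a
compact set of compact sets is compact, and the compact subsets of a compact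
Hausdorff space form a compact hyperspace. *)

(** * Separation and compactness *)

Lemma regular_closed_sep (X : topologicalType) (A : set X) (x : X) :
  regular_space X -> closed A -> ~ A x ->
  exists W : set X, [/\ open W, W x & closure W `<=` ~` A].
Proof.
move=> regX cA nAx.
have [U xU UA] : filter_from (nbhs x) closure (~` A).
  by apply: regX; apply: open_nbhs_nbhs; split=> //; exact: closed_openC.
exists U°; split; [exact: open_interior|exact: xU|].
by apply: subset_trans UA; apply: closureS; exact: interior_subset.
Qed.

Lemma regular_accessible_hausdorff (X : topologicalType) :
  regular_space X -> accessible_space X -> hausdorff_space X.
Proof.
move=> regX T1 p q pq; apply: contrapT => npq.
have [W [oW Wp WA]] := regular_closed_sep regX
  (accessible_closed_set1 T1 (x := q)) npq.
have qW : closure W q.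
  by move=> V qV; apply: pq => //; exact: open_nbhs_nbhs.
exact: WA qW erefl.
Qed.

(** The tube lemma with a filter in place of the second space.  Applying the
    near-covering property of [K] to the small members of [F], instead of to
    points of [I], makes the resulting member of [F] serve all of [K]. *)
Lemma compact_tube (X : topologicalType) (I : Type) (F : set_system I)
    (P : I -> X -> Prop) (K : set X) : ProperFilter F -> compact K ->
  (forall x, K x -> \forall x' \near x & i \near F, P i x') ->
  exists2 U : set X, open U /\ K `<=` U & \forall i \near F, U `<=` P i.
Proof.
move=> FF /compact_near_coveringP cK KP.
have /cK : forall x, K x -> \forall x' \near x &
    B \near powerset_filter_from F, nbhs x' (fun z => forall i, B i -> P i z).
  move=> x Kx; have [[U B] /= [xU FB] UB] := KP x Kx.
  exists (U°, [set C | F C /\ C `<=` B]) => /=.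
    by split; [exact: nbhs_interior|exact: powerset_filter_fromP].
  move=> [x' C] /= [Ux' [FC CB]]; apply: filterS Ux' => z Uz i Ci.
  by apply: (UB (z, i)); split=> //; exact: CB.
have mono : forall A B : set I, A `<=` B ->
    K `<=` (fun x' => nbhs x' (fun z => forall i, B i -> P i z)) ->
    K `<=` (fun x' => nbhs x' (fun z => forall i, A i -> P i z)).
  by move=> A B AB KB x /KB; apply: filterS => z BP i /AB; exact: BP.
move=> /(iffLR (near_powerset_filter_fromP _ mono))[B FB KB].
exists (interior (fun z => forall i, B i -> P i z)).
  by split; [exact: open_interior|exact: KB].
by apply: filterS FB => i Bi z /interior_subset; exact.
Qed.

(** * The Vietoris hyperspace *)

Section Hyperspace.
Variable X : topologicalType.
Implicit Type U : set X.

Lemma open_hyper_sub U : open U -> open [set K : hyperspace X | K `<=` U].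
Proof.
move=> oU; exists [set [set K : hyperspace X | K `<=` U]].
  by move=> _ ->; exact: finI_from1 (ex_intro2 _ _ U oU (or_introl erefl)).
by rewrite bigcup_set1.
Qed.

Lemma hyper_cvg (F : set_system (hyperspace X)) (L : hyperspace X) :
  Filter F ->
  (forall U, open U -> L `<=` U -> F [set K : hyperspace X | K `<=` U]) ->
  (forall U, open U -> L `&` U !=set0 ->
     F [set K : hyperspace X | K `&` U !=set0]) ->
  F --> L.
Proof.
move=> FF Fsub Fmeet S [_ [[D' sD <-] [E D'E EL] sS]].
have [D DB DE] := sD _ D'E.
have FE : F E.
  rewrite -DE; apply: filter_bigI => B DBi.
  have BL : B L by move: EL; rewrite -DE; exact.
  have /set_mem[U oU [BU|BU]] := DB _ DBi; rewrite BU in BL *.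
    exact: Fsub.
  exact: Fmeet.
by apply: filterS FE => K EK; apply: sS; exists E.
Qed.

(** By the tube lemma, what holds near each point of a compact set [K] holds on
    an open set around [K], and that open set gives a Vietoris neighbourhood. *)
Lemma bigcup_hyper_compact (C : set (hyperspace X)) :
  compact C -> compact (\bigcup_(K in C) (K : set X)).
Proof.
move=> /compact_near_coveringP cC; apply/compact_near_coveringP => I F P FF CP.
have [F0|nF0] := pselect (F set0); first by apply: filterS F0.
have PF : ProperFilter F by split.
pose PC (i : I) (K : hyperspace X) := K `<=` P i.
have /cC : forall K, C K -> \forall K' \near K & i \near F, PC i K'.
  move=> K CK; have [|U [oU KU] UP] :=
      @compact_tube X I F P K PF (hyper_compact (h := K)).
    by move=> x Kx; apply: CP; exists K.
  exists ([set K' : hyperspace X | K' `<=` U], [set i | U `<=` P i]) => /=.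
    by split=> //; apply: open_nbhs_nbhs; split=> //; exact: open_hyper_sub.
  by move=> [K' i] /= [K'U UPi]; exact: subset_trans UPi.
by apply: filterS => i CPi x [K CK Kx]; exact: CPi CK _ Kx.
Qed.

(** An ultrafilter of compact subsets of [C] converges to its upper limit, the
    set of points all of whose neighbourhoods meet almost every member. *)
Lemma hyper_sub_compact (C : set X) : hausdorff_space X -> compact C ->
  compact [set K : hyperspace X | K `<=` C].
Proof.
move=> hX cC; rewrite compact_ultra => F UF FC.
pose L : set X :=
  [set x | forall U, open U -> U x ->
     F [set K : hyperspace X | K `&` U !=set0]].
have clC : closed C by exact: compact_closed.
have LC : L `<=` C.
  move=> x Lx; apply: contrapT => nCx.
  have FU := Lx _ (closed_openC clC) nCx.
  by have [K [[y [Ky nCy]] /(_ y Ky)]] := filter_ex (filterI FU FC).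
have miss x : ~ L x ->
    exists2 U, open U /\ U x & F [set K : hyperspace X | K `&` U = set0].
  move=> /existsNP[U /not_implyP[oU /not_implyP[Ux nF]]]; exists U => //.
  have [//|] := in_ultra_setVsetC [set K : hyperspace X | K `&` U !=set0] UF.
  by apply: filterS => K /= /set0P/negP/negPn/eqP.
have missD D : compact D -> D `&` L = set0 ->
    F [set K : hyperspace X | K `&` D = set0].
  move=> /compact_near_coveringP cD DL.
  pose avoid (K : hyperspace X) (x : X) := ~ (K : set X) x.
  have /cD : forall x, D x -> \forall x' \near x & K \near F, avoid K x'.
    move=> x Dx; have [|U [oU Ux] FU] := miss x.
      by move=> Lx; have : (D `&` L) x by []; rewrite DL.
    exists (U, [set K : hyperspace X | K `&` U = set0]) => /=.
      by split=> //; exact: open_nbhs_nbhs.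
    by move=> [x' K] /= [Ux' KU] Kx'; have : (K `&` U) x' by []; rewrite KU.
  by apply: filterS => K DK; rewrite /= -subset0 => x [Kx Dx]; exact: DK Dx Kx.
have clL : closed L.
  move=> x Lx U oU Ux.
  by have [y [Ly Uy]] := Lx U (open_nbhs_nbhs (conj oU Ux)); exact: Ly.
have L0 : L !=set0.
  apply/set0P/eqP => L0; have := missD C cC; rewrite L0 setI0 => /(_ erefl) FD.
  have [K [KC0 KC]] := filter_ex (filterI FD FC).
  have [x Kx] := hyper_neq0 K.
  have : ((K : set X) `&` C) x by split=> //; exact: KC.
  by rewrite KC0.
pose LL := Hyperspace (subclosed_compact clL cC LC) L0.
exists LL; split; first exact: LC.
apply: hyper_cvg => [U oU LU|U oU [x [Lx Ux]]]; last exact: Lx Ux.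
have FD : F [set K : hyperspace X | K `&` (C `\` U) = set0].
  apply: missD; first by apply: compact_closedI => //; exact: open_closedC.
  by rewrite -subset0 => x [[_ nUx] /LU].
apply: filterS (filterI FD FC) => K [KD KC] x Kx.
apply: contrapT => nUx.
have : ((K : set X) `&` (C `\` U)) x by split=> //; split=> //; exact: KC.
by rewrite KD.
Qed.

Lemma hemicompact_hyper : hausdorff_space X ->
  hemicompact X -> hemicompact (hyperspace X).
Proof.
move=> hX [F [cF Fc Fcof]].
exists [set [set K : hyperspace X | K `<=` A] | A in F]; split.
- exact: card_le_trans (card_image_le _ _) cF.
- by move=> _ [A FA <-]; apply: hyper_sub_compact => //; exact: Fc.
move=> C /bigcup_hyper_compact /Fcof[A FA CA].
exists [set K : hyperspace X | K `<=` A].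
  by exists A.
by move=> K CK x Kx; apply: CA; exists K.
Qed.

Lemma hyper_hemicompact : hemicompact (hyperspace X) -> hemicompact X.
Proof.
move=> [F [cF Fc Fcof]].
exists [set \bigcup_(K in C) (K : set X) | C in F]; split.
- exact: card_le_trans (card_image_le _ _) cF.
- by move=> _ [C FC <-]; apply: bigcup_hyper_compact; exact: Fc.
move=> C cC; have [C0|C0] := pselect (C !=set0).
  have [A FA CA] := Fcof _ (compact_set1 (x := Hyperspace cC C0)).
  exists (\bigcup_(K in A) (K : set X)); first by exists A.
  by move=> x Cx; exists (Hyperspace cC C0) => //; exact: CA.
have [A FA _] := Fcof _ (compact0 (T := hyperspace X)).
exists (\bigcup_(K in A) (K : set X)); first by exists A.
by move=> x Cx; case: C0; exists x.
Qed.

End Hyperspace.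

(** * Minimal usco maps *)

(** If no member of the chain were contained in [V], the sets [f i `\` V] would
    be a filter base on a compact set, and a cluster point of it would lie in
    the intersection but not in [V]. *)
Lemma chain_bigcap_open (T : topologicalType) (I : Type) (D : set I)
    (f : I -> set T) (V : set T) : hausdorff_space T -> D !=set0 ->
  (forall i, D i -> compact (f i)) ->
  (forall i j, D i -> D j -> f i `<=` f j \/ f j `<=` f i) ->
  open V -> \bigcap_(i in D) f i `<=` V -> exists2 i, D i & f i `<=` V.
Proof.
move=> hT [i0 Di0] fc tot oV fV; apply: contrapT => nfV.
have out i : D i -> f i `\` V !=set0.
  move=> Di; apply/set0P/eqP; rewrite setD_eq0 => fiV.
  by apply: nfV; exists i.
pose F := filter_from D (fun i => f i `\` V).
have FF : ProperFilter F.
  apply: filter_from_proper out; apply: filter_from_filter; first by exists i0.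
  by move=> i j Di Dj; have [ij|ji] := tot _ _ Di Dj; [exists i|exists j] => //;
    move=> x [fx nVx]; split; split=> //; [exact: ij|exact: ji].
have [|p [_ Fp]] := fc _ Di0 F FF; first by exists i0 => // x [].
have pin C : closed C -> F C -> C p by move=> cC FC; apply: cC => B; exact: Fp.
have nVp : (~` V) p.
  by apply: pin; [exact: open_closedC|exists i0 => // x []].
apply: nVp; apply: fV => i Di; apply: pin; last by exists i => // x [].
exact: compact_closed (fc _ Di).
Qed.

Section Usco.
Variables (R : realType) (X : topologicalType).
Implicit Types (F G : X -> set R) (Phi Psi : MU R X).

Lemma set_graphS F G : (forall x, F x `<=` G x) <-> set_graph F `<=` set_graph G.
Proof. by split=> [FG [x y] /FG//|FG x y Fxy]; exact: (FG (x, y)). Qed.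

Lemma usco_minimalE F G : minimal_usco F -> usco G ->
  (forall x, G x `<=` F x) -> G = F.
Proof.
move=> [_ minF] uG /set_graphS /(minF _ uG) GF.
by apply/funext => x; apply/seteqP; split; move: x; apply/set_graphS; rewrite GF.
Qed.

Lemma MU_eqP Phi Psi : (Phi : X -> set R) = Psi -> Phi = Psi.
Proof. case: Phi Psi => f fP [g gP] /= fg; rewrite fg in fP *.
by congr MkMU; exact: Prop_irrelevance. Qed.

(** Zorn on the uscos below [F]; compactness of the values keeps the pointwise
    intersection of a chain non-empty and upper semicontinuous. *)
Lemma usco_minimal_sub F : usco F ->
  exists2 G, minimal_usco G & forall x, G x `<=` F x.
Proof.
move=> uF; pose T := {G : X -> set R | usco G /\ forall x, G x `<=` F x}.
pose below (s t : T) := `[< forall x, sval t x `<=` sval s x >].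
have [||||t tmax] := @Zorn T below.
- by move=> t; apply/asboolP => x; exact: subset_refl.
- move=> r s t /asboolP rs /asboolP st; apply/asboolP => x.
  exact: subset_trans (rs x).
- move=> [s sP] [t tP] /asboolP /= st /asboolP /= ts; apply/eq_exist/funext => x.
  by apply/seteqP; split; [exact: ts|exact: st].
- move=> A totA; pose tF : T := exist _ F (conj uF (fun x => @subset_refl _ _)).
  pose D := [set t : T | t = tF \/ A t].
  have DF : D tF by left.
  pose f x (t : T) := sval t x.
  have fc x t : D t -> compact (f x t).
    by move=> _; have [[GP _] _] := svalP t; have [] := GP x.
  have tot x s t : D s -> D t -> f x s `<=` f x t \/ f x t `<=` f x s.
    have belowF (u : T) : f x u `<=` f x tF by have [_] := svalP u; exact.
    move=> [->|As] [->|At]; [left|right|left|]; try exact: belowF.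
    have [/asboolP st|/asboolP ts] := totA _ _ As At.
      by right; exact: st.
    by left; exact: ts.
  have chain x V : open V -> \bigcap_(t in D) f x t `<=` V ->
      exists2 t, D t & f x t `<=` V.
    exact: chain_bigcap_open (@Rhausdorff R) (ex_intro _ tF DF) (fc x) (tot x).
  pose G x := \bigcap_(t in D) f x t.
  have Gsub x t : D t -> G x `<=` f x t by move=> Dt y; exact.
  have uG : usco G.
    split=> [x|V oV].
      split.
        apply/set0P/eqP => G0; have [|t Dt] := chain x _ open0.
          by rewrite -/(G x) G0.
        by move=> g0; have [[gP _] _] := svalP t; have [[y /g0]] := gP x.
      apply: (subclosed_compact _ (fc x _ DF) (Gsub x _ DF)).
      by apply: closed_bigI => t Dt; apply: compact_closed (fc x _ Dt);
        exact: Rhausdorff.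
    rewrite openE => x /(chain x _ oV)[t Dt tV]; rewrite /interior nbhsE /=.
    exists [set x' | f x' t `<=` V].
      by split=> //; have [[_ gV] _] := svalP t; exact: gV.
    by move=> x' tV'; exact: subset_trans (Gsub _ _ Dt) tV'.
  exists (exist _ G (conj uG (fun x => Gsub x tF DF))) => s As.
  by apply/asboolP => x; apply: Gsub; right.
case: t tmax => G [uG GF] tmax; exists G => //; split=> // H uH HG.
have {}HG x : H x `<=` G x by move: x; exact/set_graphS.
have HF x : H x `<=` F x by exact: subset_trans (GF x).
have := tmax (exist _ H (conj uH HF)).
by move=> /(_ (asboolT HG)) [->].
Qed.

(** A minimal usco map may be replaced by a constant over an open set [W]
    without being disturbed off the closure of [W].  Near the boundary of [W]
    both options are allowed, and minimality decides. *)
Lemma MU_modify Phi (W : set X) (c : R) : open W ->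
  exists Psi : MU R X, (forall x, W x -> Psi x = [set c]) /\
    (forall x, ~ closure W x -> Psi x = Phi x).
Proof.
move=> oW; have [[Pne PV] _] := MU_minimal Phi.
pose T x := [set y | closure W x /\ y = c \/ ~ W x /\ Phi x y].
have TW x : W x -> T x = [set c].
  move=> Wx; apply/seteqP; split=> [y [[]|[]]//|y ->].
  by left; split=> //; exact: subset_closure.
have TC x : ~ closure W x -> T x = Phi x.
  move=> nx; apply/seteqP; split=> [y [[]|[]]//|y Py]; right; split=> // Wx.
  by apply: nx; exact: subset_closure.
have uT : usco T.
  split=> [x|V oV].
    have [Wx|nWx] := pselect (W x).
      by rewrite TW //; split; [exists c|exact: compact_set1].
    have [Cx|/TC->//] := pselect (closure W x).
    have -> : T x = [set c] `|` Phi x.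
      apply/seteqP; split=> y; first by move=> [[]|[]]; [left|right].
      by move=> [->|?]; [left|right].
    split; first by exists c; left.
    by apply: compactU; [exact: compact_set1|have [] := Pne x].
  have [Vc|nVc] := pselect (V c).
    rewrite (_ : [set _ | _] = W `|` [set x | Phi x `<=` V]).
      by apply: openU => //; exact: PV.
    apply/seteqP; split=> x.
      move=> TV; have [Wx|nWx] := pselect (W x); [by left|right=> y Py].
      by apply: TV; right.
    by move=> [/TW /= ->|PVx] y => [->//|[[_ ->]|[_ /PVx]]].
  rewrite (_ : [set _ | _] = ~` closure W `&` [set x | Phi x `<=` V]).
    by apply: openI; [apply: closed_openC; exact: closed_closure|exact: PV].
  apply/seteqP; split=> x; last by move=> [/TC /= ->].
  move=> TV; have nCx : ~ closure W x by move=> Cx; apply: nVc; apply: TV; left.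
  by split=> //=; rewrite -TC.
have [S mS ST] := usco_minimal_sub uT; have [[Sne SV] _] := mS.
exists (MkMU mS); split=> [x Wx|] /=.
  have [[y Sy] _] := Sne x; have := ST x; rewrite TW // => Sc.
  by apply/seteqP; split=> // _ ->; have <- := Sc _ Sy.
(* Gluing S off the closure of W with Phi over it gives a usco below Phi. *)
pose P' x := [set y | ~ closure W x /\ S x y \/ closure W x /\ Phi x y].
have P'C x : ~ closure W x -> P' x = S x.
  by move=> nx; apply/seteqP; split=> [y [[]|[]]|y]//; left.
have P'W x : closure W x -> P' x = Phi x.
  by move=> nx; apply/seteqP; split=> [y [[]|[]]|y]//; right.
have P'P x : P' x `<=` Phi x.
  have [/P'W->//|nCx] := pselect (closure W x).
  by rewrite P'C // -TC.
suff P'E : P' = Phi by move=> x nCx; rewrite -P'C // P'E.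
apply: (usco_minimalE _ _ P'P); first exact: MU_minimal.
split=> [x|V oV].
  by have [/P'W->|/P'C->] := pselect (closure W x).
rewrite (_ : [set _ | _] =
    ~` closure W `&` [set x | S x `<=` V] `|` [set x | Phi x `<=` V]).
  apply: openU; last exact: PV.
  by apply: openI; [apply: closed_openC; exact: closed_closure|exact: SV].
apply/seteqP; split=> x /=.
  have [Cx|nCx] := pselect (closure W x); first by rewrite P'W//; right.
  by rewrite P'C//; left.
by move=> [[nCx]|/(subset_trans (P'P x))//]; rewrite P'C.
Qed.

Lemma MU_const (c : R) : exists Phi, forall x, Phi x = [set c].
Proof.
have [Phi [PhiT _]] := MU_modify (MU_zero R X) c openT.
by exists Phi => x; exact: PhiT.
Qed.

Lemma MU_bounded Phi (A : set X) : compact A ->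
  exists M : R, forall x y, A x -> Phi x y -> `|y| <= M.
Proof.
have [[Pne PV] _] := MU_minimal Phi => /compact_near_coveringP cA.
pose P (M : R) x := forall y, Phi x y -> `|y| <= M.
have /cA : forall x, A x -> \forall x' \near x & M \near +oo, P M x'.
  move=> x _; have [_ /compact_bounded[N [_ NP]]] := Pne x.
  pose V := [set y : R | `|y| < N + 2].
  have oV : open V.
    by apply: open_comp (@open_lt _ (N + 2)) => y _; exact: norm_continuous.
  exists ([set x' | Phi x' `<=` V], [set M | N + 2 < M]) => /=.
    split; last by exists (N + 2); rewrite num_real.
    apply: open_nbhs_nbhs; split; first exact: PV.
    move=> y Py; apply: (@le_lt_trans _ _ (N + 1)).
      by apply: (NP (N + 1)) => //; rewrite ltrDl.
    by rewrite ltrD2l ltr1n.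
  by move=> [x' M] /= [PV' NM] y /PV' /ltW /le_trans; apply; exact: ltW.
move=> [M [_ MP]]; exists (M + 1) => x y Ax; apply: MP => //.
by rewrite ltrDl.
Qed.

End Usco.

(** * Metrizability and discrete selectivity *)

(** The distance of [x] and [y] is the infimum of the [e] such that [E e x y];
    it is finite because [E 1] is total. *)
Lemma metrizable_gauge (R : realType) (Z : topologicalType)
    (E : R -> Z -> Z -> Prop) :
  (forall x y, E 1 x y) ->
  (forall e f x y, e <= f -> E e x y -> E f x y) ->
  (forall e x y, E e x y -> E e y x) ->
  (forall (e f : R) x y z, 0 < e -> 0 < f ->
     E e x y -> E f y z -> E (e + f) x z) ->
  (forall x y, (forall e : R, 0 < e -> E e x y) <-> x = y) ->
  (forall O : set Z, open O <->
     forall x, O x -> exists2 e : R, 0 < e & E e x `<=` O) ->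
  metrizable R Z.
Proof.
move=> E1 mono sym tri sep openE.
pose S x y := [set e : R | 0 < e /\ E e x y]; pose d x y := inf (S x y).
have S1 x y : S x y 1 by split=> //; exact: E1.
have lbS x y : lbound (S x y) 0 by move=> e [/ltW].
have infS x y : has_inf (S x y) by split; [exists 1|exists 0].
have dE (e : R) x y : 0 < e -> E e x y -> d x y <= e.
  by move=> e0 Ee; apply: ge_inf; [have [] := infS x y|split].
have Ed (e : R) x y : d x y < e -> E e x y.
  by move=> /(inf_lt (infS x y).1)[f [f0 Ef] /ltW fe]; exact: mono Ef.
have d0 x y : 0 <= d x y by apply: lb_le_inf; [exists 1|].
exists d; split=> [x y|x y|x y z|O].
- split=> [dxy|/sep xy].
    by apply/sep => e e0; apply: Ed; rewrite dxy.
  apply/eqP; rewrite eq_le d0 andbT; apply/ler_addgt0Pr => e e0.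
  by rewrite add0r; apply: dE => //; exact: xy.
- by congr inf; apply/seteqP; split=> e [e0 /sym].
- apply/ler_addgt0Pl => e e0; have e20 : 0 < e / 2 by rewrite divr_gt0.
  have h u v : E (d u v + e / 2) u v by apply: Ed; rewrite ltrDl.
  have p u v : 0 < d u v + e / 2 by rewrite ltr_wpDl.
  have -> : e + (d x y + d y z) = (d x y + e / 2) + (d y z + e / 2) by lra.
  by apply: dE; [exact: addr_gt0|exact: tri (h x y) (h y z)].
- rewrite openE; split=> h x /h[e e0 sub].
    by exists e => // y; rewrite /= => /Ed/sub.
  exists (e / 2); first by rewrite divr_gt0.
  move=> y Ey; apply: sub; apply: (@le_lt_trans _ _ (e / 2)); last by lra.
  by apply: dE; rewrite // divr_gt0.
Qed.

(** Selecting from shrinking punctured balls around a non-isolated point gives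
    a sequence that converges to that point without meeting it. *)
Lemma metrizable_not_discretely_selective (R : realType) (Z : topologicalType)
    (z : Z) :
  (forall O : set Z, open O -> O z -> exists2 y, O y & y <> z) ->
  metrizable R Z -> ~ discretely_selective Z.
Proof.
move=> niso [d [d0 dsym dtri dO]] ds.
have dge0 x y : 0 <= d x y.
  have := dtri x y x; rewrite (dsym y x) (iffRL (d0 x x) erefl); lra.
have dpos x y : x <> y -> 0 < d x y.
  by move=> xy; rewrite lt_neqAle dge0 andbT eq_sym; apply/eqP => /d0.
have dball (e : R) : 0 < e -> open [set y | d z y < e].
  move=> e0; apply/dO => x /= zx; exists (e - d z x); first by rewrite subr_gt0.
  by move=> y /= xy; have := dtri z x y; lra.
pose O n := [set y | 0 < d z y < n.+1%:R^-1].
have oO n : open (O n).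
  apply/dO => x /= /andP[zx xn].
  exists (Num.min (d z x) (n.+1%:R^-1 - d z x)).
    by rewrite lt_min zx subr_gt0.
  move=> y /=; rewrite lt_min => /andP[yx yn].
  have := dtri z x y; have := dtri z y x; rewrite (dsym y x) => zx' zy.
  apply/andP; split; first by lra.
  by apply: le_lt_trans zy _; rewrite -ltrBrDl.
have [|s [Os [cs _]]] := ds O.
  move=> n; split=> //.
    have [||y zy yz] := niso [set y | d z y < n.+1%:R^-1].
    - by apply: dball; rewrite invr_gt0.
    - by rewrite /= (iffRL (d0 z z) erefl) invr_gt0.
    - by exists y; rewrite /O /= zy andbT dpos // => /esym.
  apply/eqP => OT; have : O n z by rewrite OT.
  by rewrite /O /= (iffRL (d0 z z) erefl) ltxx.
have nsz : (~` range s) z.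
  by move=> [n _ sz]; have := Os n; rewrite /O /= sz (iffRL (d0 z z) erefl) ltxx.
have [e e0 sub] := iffLR (dO _) (closed_openC cs) z nsz.
pose n := Num.truncn e^-1.
apply: (sub (s n)); last by exists n.
have /andP[_] := Os n => /lt_trans; apply.
by rewrite invf_plt ?posrE // truncnS_gt.
Qed.

(** If every point has a neighbourhood that only finitely many terms enter, the
    range of a sequence has no accumulation point. *)
Lemma closed_discrete_range (Z : topologicalType) (s : nat -> Z) :
  accessible_space Z ->
  (forall z : Z, exists2 V, nbhs z V &
     exists m, forall n, (m <= n)%N -> ~ V (s n)) ->
  closed_discrete (range s).
Proof.
move=> T1 sV.
have {}sV (z : Z) : exists2 V, nbhs z V & V `&` range s `<=` [set z].
  have [V zV [m Vm]] := sV z.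
  have fs : finite_set (s @` `I_m `\ z).
    by apply: finite_setD; apply: finite_image; exact: finite_II.
  exists (V `&` ~` (s @` `I_m `\ z)).
    apply: filterI => //; apply: open_nbhs_nbhs; split; last by move=> [_]; exact.
    by apply: closed_openC; exact: (iffLR accessible_finite_set_closed).
  move=> y [[Vy nsy] [n _ sn]]; apply: contrapT => yz.
  have [mn|nm] := leqP m n; first by apply: (Vm n mn); rewrite sn.
  by apply: nsy; split=> //; exists n.
split=> [z cz|z sz].
  have [V zV Vs] := sV z; have [y [sy Vy]] := cz V zV.
  by have <- : y = z by exact: Vs.
split; first exact: mem_set.
have [V zV Vs] := sV z; exists V => //.
by apply/seteqP; split=> // _ ->; split=> //; exact: nbhs_singleton.
Qed.

(** * Countably cofinal families *)

Definition countably_cofinal (T : Type) (fam : set (set T)) : Prop :=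
  exists2 A : nat -> set T, (forall n, fam (A n)) &
    forall B, fam B -> exists n, B `<=` A n.

Lemma countably_cofinal_mono (T : Type) (fam : set (set T)) :
  setU_closed fam -> countably_cofinal fam ->
  exists A : nat -> set T, [/\ forall n, fam (A n),
    forall m n, (m <= n)%N -> A m `<=` A n &
    forall B, fam B -> exists n, B `<=` A n].
Proof.
move=> famU [A famA cofA].
pose B := fix B n := if n is m.+1 then B m `|` A n else A 0%N.
have BS n : B n `<=` B n.+1 by exact: subsetUl.
exists B; split=> [|m n /subnK<-|C /cofA[n CA]].
- by elim=> [|n IH] //=; apply: famU.
- by elim: (n - m)%N => [|k IH] //; exact: subset_trans (BS _).
- exists n; apply: subset_trans CA _.
  by case: n => [|n] //=; exact: subsetUr.
Qed.

Definition family_covers (X : topologicalType) (fam : set (set X)) :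
    set (set (set X)) :=
  [set U | nontrivial_open_cover U /\
    forall A, fam A -> exists2 V, U V & A `<=` V].

(** * Uniform convergence on a family of compact sets *)

Section MUballTheory.
Variables (R : realType) (X : topologicalType).
Implicit Types (Phi Psi : MU R X) (A : set X) (e f : R).

Lemma MU_ball_refl Phi A e : 0 < e -> MU_ball Phi A e Phi.
Proof. by move=> e0 x _; split=> y Py; exists y; rewrite // subrr normr0. Qed.

Lemma MU_ball_sym Phi Psi A e : MU_ball Phi A e Psi -> MU_ball Psi A e Phi.
Proof. by move=> h x /h[]. Qed.

Lemma MU_ball_triangle Phi Psi Theta A e f :
  MU_ball Phi A e Psi -> MU_ball Psi A f Theta -> MU_ball Phi A (e + f) Theta.
Proof.
move=> h k x Ax; have [h1 h2] := h x Ax; have [k1 k2] := k x Ax.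
split=> y => [/h1[z /k1[w ? zw] yz]|/k2[z /h2[w ? zw] yz]]; exists w => //.
  exact: le_lt_trans (ler_distD z _ _) (ltrD yz zw).
by rewrite (addrC e); exact: le_lt_trans (ler_distD z _ _) (ltrD yz zw).
Qed.

Lemma MU_ball_sep Phi Psi :
  (forall x e, 0 < e -> MU_ball Phi [set x] e Psi) -> Phi = Psi.
Proof.
have closure_sub (F : set R) (y : R) : compact F ->
    (forall e, 0 < e -> exists2 z, F z & `|y - z| < e) -> F y.
  move=> cF Fy; have clF := compact_closed (@Rhausdorff R) cF; apply: clF => V.
  move=> /nbhs_ballP[e /= e0 eV]; have [z Fz yz] := Fy e e0.
  by exists z; split=> //; exact: eV.
move=> h; apply: MU_eqP; apply/funext => x.
have [[P1 _] _] := MU_minimal Phi; have [[P2 _] _] := MU_minimal Psi.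
apply/seteqP; split=> y Py; apply: closure_sub => [|e e0].
- by have [] := P2 x.
- by have [+ _] := h x e e0 x erefl; exact.
- by have [] := P1 x.
- by have [_ +] := h x e e0 x erefl; exact.
Qed.

End MUballTheory.

(** The topology of [Phi; A, e]-neighbourhoods with [A] in an arbitrary ideal
    base, so that the finite and the compact case are treated at once. *)
Definition MUfam (R : realType) (X : topologicalType) (fam : set (set X))
  (famU : setU_closed fam) : Type := MU R X.

HB.instance Definition _ R X fam famU := gen_eqMixin (@MUfam R X fam famU).
HB.instance Definition _ R X fam famU := gen_choiceMixin (@MUfam R X fam famU).
HB.instance Definition _ R X fam famU := isOpenTopological.Build
  (@MUfam R X fam famU)
  (@MU_openT R X fam) (@MU_openI R X fam famU) (@MU_open_bigU R X fam).

Section Family.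
Variables (R : realType) (X : topologicalType) (fam : set (set X)).
Hypotheses (regX : regular_space X) (T1X : accessible_space X).
Hypothesis X0 : [set: X] !=set0.
Hypotheses (famU : setU_closed fam) (fam1 : forall x, fam [set x])
  (famC : forall A, fam A -> compact A) (fam0 : forall A, fam A -> A !=set0).

Local Notation Z := (MUfam R famU).
Let zero : Z := MU_zero R X.
Implicit Types Phi Psi : Z.

Lemma MUfam_openE (O : set Z) : open O <->
  forall Phi, O Phi -> exists (A : set X) (e : R),
    [/\ fam A, 0 < e & MU_ball Phi A e `<=` O].
Proof. by have [x _] := X0; apply: MU_openE; exists [set x]. Qed.

(** [Phi; A, e] need not be open, since the distances over [A] may have
    supremum [e] without attaining it; the maps that keep some margin form an
    open subset. *)
Lemma nbhs_MU_ball Phi A (e : R) : fam A -> 0 < e ->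
  nbhs Phi (MU_ball Phi A e : set Z).
Proof.
move=> famA e0; exists [set Psi : Z |
  exists2 f : R, 0 < f & MU_ball Psi A f `<=` MU_ball Phi A e].
split.
- apply/MUfam_openE => Psi [f f0 fe]; exists A, (f / 2).
  have f20 : 0 < f / 2 by rewrite divr_gt0.
  split=> // Theta PT; exists (f / 2) => // Xi TX; apply: fe.
  by rewrite (splitr f); exact: MU_ball_triangle TX.
- by exists e.
- by move=> Psi [f f0]; apply; exact: MU_ball_refl.
Qed.

Lemma nbhs_MUfamP Phi (S : set Z) : nbhs Phi S <->
  exists (A : set X) (e : R), [/\ fam A, 0 < e & MU_ball Phi A e `<=` S].
Proof.
split=> [[ O [/MUfam_openE oO /oO[A [e [fA e0 AO]]] OS]]|[A [e [fA e0 sub]]]].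
  by exists A, e; split=> //; exact: subset_trans OS.
by apply: filterS sub _; exact: nbhs_MU_ball.
Qed.

Lemma MUfam_clusterP Phi (S : set Z) : closure S Phi <->
  forall (A : set X) (e : R), fam A -> 0 < e -> MU_ball Phi A e `&` S !=set0.
Proof.
split=> [cS A e fA e0|h B /nbhs_MUfamP[A [e [fA e0 sub]]]].
  by rewrite setIC; apply: cS; exact: nbhs_MU_ball.
by have [Psi [/sub BPsi SPsi]] := h A e fA e0; exists Psi.
Qed.

Lemma MUfam_accessible : accessible_space Z.
Proof.
move=> Phi Psi /eqP PP.
have [x [e [e0 nb]]] : exists x (e : R), 0 < e /\ ~ MU_ball Phi [set x] e Psi.
  apply: contrapT => h; apply: PP; apply: MU_ball_sep => x e e0.
  by apply: contrapT => nb; apply: h; exists x, e.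
have := nbhs_MU_ball Phi (fam1 x) e0.
rewrite nbhsE => -[ O [oO OPhi] sub]; exists O; split=> //; first exact: mem_set.
by apply: mem_set => /sub.
Qed.

Lemma MUfam_zero_not_isolated (O : set Z) :
  open O -> O zero -> exists2 Psi, O Psi & Psi <> zero.
Proof.
move=> /MUfam_openE oO /oO[A [e [fA e0 AO]]].
have [Psi Psie] := MU_const X (e / 2).
have e20 : 0 < e / 2 by rewrite divr_gt0.
have e2e : e / 2 < e by rewrite ltr_pdivrMr // ltr_pMr // ltr1n.
exists Psi.
  apply: AO => x _; rewrite Psie; split=> y /= ->.
    by exists (e / 2); rewrite // sub0r normrN gtr0_norm.
  by exists 0; rewrite // subr0 gtr0_norm.
move=> Psi0; have [x _] := X0; have := Psie x; rewrite Psi0 /= => /seteqP[+ _].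
by move=> /(_ 0 erefl) /= h; rewrite -h ltxx in e20.
Qed.

(** Two maps are [e]-close when they differ by less than [e] on those [A n] with
    [(n + 1) * e < 1].  Adding two radii leaves fewer [n] to check, which is the
    triangle inequality of this gauge. *)
Lemma cofinal_metrizable : countably_cofinal fam -> metrizable R Z.
Proof.
move=> /(countably_cofinal_mono famU)[A [famA mono cof]].
pose E (e : R) (Phi Psi : Z) :=
  forall n, n.+1%:R * e < 1 -> MU_ball Phi (A n) e Psi.
have E_ball B (e : R) : fam B -> 0 < e ->
    exists2 f : R, 0 < f & forall Phi, E f Phi `<=` MU_ball Phi B e.
  move=> /cof[n BA] e0; pose f := Num.min e n.+2%:R^-1.
  exists f => [|Phi Psi /(_ n) En]; first by rewrite lt_min e0 invr_gt0 /=.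
  apply: MU_ball_sub BA _ _ (En _); first by rewrite ge_min lexx.
  apply: (@le_lt_trans _ _ (n.+1%:R / n.+2%:R)).
    by rewrite ler_wpM2l // ge_min lexx orbT.
  by rewrite ltr_pdivrMr // mul1r ltr_nat.
have ball_E (e : R) : 0 < e ->
    exists2 B, fam B & forall Phi, MU_ball Phi B e `<=` E e Phi.
  move=> e0; pose N := Num.truncn e^-1; exists (A N) => // Phi Psi PP n ne.
  apply: MU_ball_sub (mono _ _ _) (lexx e) _ PP.
  rewrite leqNgt; apply/negP => Nn; move: ne; apply/negP; rewrite -leNgt.
  rewrite -ler_pdivrMr // mul1r; apply: ltW; apply: lt_le_trans (truncnS_gt _) _.
  by rewrite ler_nat ltnW.
apply: (metrizable_gauge (E := E)).
- by move=> Phi Psi n; rewrite mulr1 ltNge ler1n.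
- move=> e f Phi Psi ef Ee n nf; apply: (MU_ball_sub (@subset_refl _ _) ef).
  by apply: (Ee n); apply: (le_lt_trans _ nf); rewrite ler_wpM2l.
- by move=> e Phi Psi Ee n /Ee; exact: MU_ball_sym.
- move=> e f Phi Psi Theta e0 f0 Ee Ef n nef.
  by apply: MU_ball_triangle (Ee n _) (Ef n _); apply: (le_lt_trans _ nef);
    rewrite ler_wpM2l // ?lerDl ?lerDr ltW.
- move=> Phi Psi; split=> [h|-> e e0 n _]; last exact: MU_ball_refl.
  apply: MU_ball_sep => x e e0; have [f f0 Ef] := E_ball _ _ (fam1 x) e0.
  by apply: Ef; exact: h.
- move=> O; split=> [/MUfam_openE oO Phi /oO[B [e [fB e0 sub]]]|h].
    have [f f0 Ef] := E_ball _ _ fB e0; exists f => //.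
    exact: subset_trans (Ef _) sub.
  apply/MUfam_openE => Phi /h[e e0 sub]; have [B fB BE] := ball_E e e0.
  by exists B, e; split=> //; exact: subset_trans (BE _) sub.
Qed.

Lemma MU_ball_value Phi A (e : R) (x : X) (c : R) : fam A -> 0 < e -> ~ A x ->
  exists2 Psi, MU_ball Phi A e Psi & (Psi : MU R X) x = [set c].
Proof.
move=> fA e0 nAx.
have clA : closed A.
  by apply: compact_closed (famC fA); exact: regular_accessible_hausdorff.
have [W [oW Wx WA]] := regular_closed_sep regX clA nAx.
have [Psi [PsiW PsiC]] := MU_modify Phi c oW.
exists Psi; last exact: PsiW.
move=> z Az; rewrite PsiC; first exact: (MU_ball_refl Phi (A := A) e0 Az).
by move=> /WA.
Qed.

Lemma not_cofinal_escape (A : nat -> set X) : ~ countably_cofinal fam ->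
  (forall n, fam (A n)) ->
  exists2 B, fam B & exists x : nat -> X, forall n, B (x n) /\ ~ A n (x n).
Proof.
move=> ncof famA; apply: contrapT => h; apply: ncof; exists A => // B fB.
apply: contrapT => nBA; apply: h; exists B => //.
suff /choice[x xP] : forall n, exists x, B x /\ ~ A n x by exists x.
move=> n; apply: contrapT => nx; apply: nBA; exists n => x Bx.
by apply: contrapT => nAx; apply: nx; exists x.
Qed.

(** The selected maps take the value [n] at a point [x n] of one fixed compact
    set [B], on which every usco map is bounded; so [Phi; B, 1] contains only
    finitely many of them. *)
Lemma not_cofinal_discretely_selective :
  ~ countably_cofinal fam -> discretely_selective Z.
Proof.
move=> ncof O OP.
have /choice[AePhi AP] : forall n, exists t : set X * R * Z,
    [/\ fam t.1.1, 0 < t.1.2 & MU_ball t.2 t.1.1 t.1.2 `<=` O n].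
  move=> n; have [/MUfam_openE oO [Phi /oO[A [e [? ? ?]]]] _] := OP n.
  by exists (A, e, Phi).
pose A n := (AePhi n).1.1.
have [||B fB [x xP]] := @not_cofinal_escape A => //.
  by move=> n; have [] := AP n.
have /choice[s sP] : forall n, exists Psi : Z,
    O n Psi /\ (Psi : MU R X) (x n) = [set n%:R].
  move=> n; have [fA e0 sub] := AP n; have [_ nAx] := xP n.
  have [Psi PA Px] := MU_ball_value (AePhi n).2 n%:R fA e0 nAx.
  by exists Psi; split=> //; exact: sub.
exists s; split=> [n|]; first by have [] := sP n.
apply: closed_discrete_range; first exact: MUfam_accessible.
move=> Phi; have [M PhiM] := MU_bounded Phi (famC fB).
exists (MU_ball Phi B 1); first exact: nbhs_MU_ball.
exists (Num.truncn (M + 1)).+1 => n Mn PB.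
have [Bx _] := xP n; have [_ sx] := sP n.
have [_] := PB _ Bx; rewrite sx => /(_ n%:R erefl)[y /(PhiM _ _ Bx) yM ny].
have : (n%:R : R) < M + 1.
  by have := ler_norm y; have := ler_norm (n%:R - y); lra.
apply/negP; rewrite -leNgt; apply: ltW; apply: lt_le_trans (truncnS_gt _) _.
by rewrite ler_nat.
Qed.

Lemma cofinal_mark_covers : countably_cofinal fam ->
  II_mark_G1 (family_covers fam) (family_covers fam).
Proof.
move=> [A famA cof].
have /choice[tau tauP] : forall Un : set (set X) * nat, exists V,
    family_covers fam Un.1 -> Un.1 V /\ A Un.2 `<=` V.
  move=> [U n] /=; have [[_ cU]|nU] := pselect (family_covers fam U).
    by have [V UV AV] := cU _ (famA n); exists V.
  by exists set0.
exists (fun U n => tau (U, n)); split=> [U n /(tauP (U, n))[]//|U cU].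
have Vn n : U n (tau (U n, n)) /\ A n `<=` tau (U n, n).
  by exact: (tauP (U n, n) (cU n)).
have cov B : fam B -> exists2 V, range (fun n => tau (U n, n)) V & B `<=` V.
  move=> /cof[n BA]; exists (tau (U n, n)); first by exists n.
  by apply: subset_trans BA _; have [] := Vn n.
split=> //; split.
- by move=> _ [n _ <-]; have [[+ _ _ _] _] := cU n; apply; have [] := Vn n.
- apply/seteqP; split=> // x _; have [V rV xV] := cov _ (fam1 x).
  by exists V => //; exact: xV.
- move=> [n _ V0]; have [[_ _ + _] _] := cU n; apply.
  by rewrite -V0; have [] := Vn n.
- move=> [n _ VT]; have [[_ _ _ +] _] := cU n; apply.
  by rewrite -VT; have [] := Vn n.
Qed.

(** At each round some member [A] of the family is such that every proper open
    superset of [A] is a possible answer of Two: otherwise the open sets that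
    Two never answers at this round would form a cover One can play. *)
Lemma mark_covers_cofinal :
  II_mark_G1 (family_covers fam) (family_covers fam) -> countably_cofinal fam.
Proof.
move=> [tau [tauS tauW]].
have /choice[A AP] : forall n, exists A, fam A /\
    forall V, open V -> V <> setT -> A `<=` V ->
      exists2 U, family_covers fam U & tau U n = V.
  move=> n; apply: contrapT => h.
  pose U := [set V | [/\ open V, V <> setT, V !=set0 &
    forall U', family_covers fam U' -> tau U' n <> V]].
  have Ucov B : fam B -> exists2 V, U V & B `<=` V.
    move=> fB; apply: contrapT => nV; apply: h; exists B; split=> // V oV VT BV.
    apply: contrapT => nU; apply: nV; exists V => //; split=> //.
      by have [x Bx] := fam0 fB; exists x; exact: BV.
    by move=> U' cU' tV; apply: nU; exists U'.
  have cU : family_covers fam U.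
    split=> //; split.
    - by move=> V [].
    - by apply/seteqP; split=> // x _; have [V UV xV] := Ucov _ (fam1 x);
        exists V => //; exact: xV.
    - by move=> [_ _ []].
    - by move=> [].
  by have [_ _ _ /(_ U cU)] := tauS U n cU.
apply: contrapT => ncof.
have [||B fB [x xP]] := @not_cofinal_escape A => //.
  by move=> n; have [] := AP n.
have /choice[U UP] : forall n, exists U,
    family_covers fam U /\ tau U n = ~` [set x n].
  move=> n; have [_ +] := AP n; have [_ nAx] := xP n.
  move=> /(_ (~` [set x n]))[||y Ay yx|U cU tU]; last by exists U.
  - by apply: closed_openC; exact: accessible_closed_set1.
  - by move=> /seteqP[_ /(_ (x n) I)]; exact.
  - by apply: nAx; rewrite -yx.
have [_ cov] := tauW U (fun n => (UP n).1).
have [_ [n _ <-] BV] := cov B fB.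
by have [Bx _] := xP n; have [_ tU] := UP n; have := BV _ Bx; rewrite tU; exact.
Qed.

Lemma cofinal_mark_clusters : countably_cofinal fam ->
  II_mark_G1 (clusters_at zero) (clusters_at zero).
Proof.
move=> /(countably_cofinal_mono famU)[A [famA mono cof]].
have /choice[tau tauP] : forall Sn : set Z * nat, exists Psi : Z,
    closure Sn.1 zero -> Sn.1 Psi /\ MU_ball zero (A Sn.2) Sn.2.+1%:R^-1 Psi.
  move=> [S n] /=; have [/MUfam_clusterP cS|nS] := pselect (closure S zero).
    by have [|Psi [? ?]] := cS _ n.+1%:R^-1 (famA n); [rewrite invr_gt0|exists Psi].
  by exists zero.
exists (fun S n => tau (S, n)); split=> [S n /(tauP (S, n))[]//|S cS].
apply/MUfam_clusterP => B e /cof[m BA] e0.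
(* Round [n] serves both the set [B] and the radius [e]. *)
pose n := maxn m (Num.truncn e^-1); exists (tau (S n, n)); split; last by exists n.
have [_] := tauP (S n, n) (cS n); apply: MU_ball_sub.
  by apply: subset_trans BA _; apply: mono; exact: leq_maxl.
rewrite invf_ple ?posrE //=; apply: ltW; apply: lt_le_trans (truncnS_gt _) _.
by rewrite ler_nat ltnS leq_maxr.
Qed.

Lemma mark_clusters_mark_dense :
  II_mark_G1 (clusters_at zero) (clusters_at zero) ->
  II_mark_G1 (dense_sets Z) (clusters_at zero).
Proof.
have dense_cl S : dense S -> closure S zero.
  move=> dS B; rewrite nbhsE => -[ O [oO Oz] OB].
  by have [y [Oy Sy]] := dS O (ex_intro _ _ Oz) oO; exists y; split=> //; exact: OB.
move=> [tau [tauS tauW]]; exists tau; split=> [S n dS|S dS].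
  by apply: tauS; exact: dense_cl.
by apply: tauW => n; exact: dense_cl (dS n).
Qed.

(** At each round the answers of Two to dense sets fill a non-empty open set,
    since otherwise the complement of these answers would be dense. *)
Lemma mark_dense_cofinal :
  II_mark_G1 (dense_sets Z) (clusters_at zero) -> countably_cofinal fam.
Proof.
move=> [tau [tauS tauW]].
have /choice[t tP] : forall n, exists t : set X * R * Z,
    [/\ fam t.1.1, 0 < t.1.2 & forall Psi, MU_ball t.2 t.1.1 t.1.2 Psi ->
      exists2 S, dense S & tau S n = Psi].
  move=> n; apply: contrapT => h.
  pose S : set Z := [set Psi | forall S', dense S' -> tau S' n <> Psi].
  have dS : dense S.
    move=> O [Phi OPhi] /MUfam_openE/(_ _ OPhi)[A [e [fA e0 sub]]].
    apply: contrapT => OS; apply: h; exists (A, e, Phi); split=> // Psi /sub OPsi.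
    apply: contrapT => nS; apply: OS; exists Psi; split=> // S' dS' tS'.
    by apply: nS; exists S'.
  exact: (tauS S n dS) dS erefl.
apply: contrapT => ncof; pose A n := (t n).1.1.
have [||B fB [x xP]] := @not_cofinal_escape A => //.
  by move=> n; have [] := tP n.
have /choice[S SP] : forall n, exists S : set Z,
    dense S /\ (tau S n : MU R X) (x n) = [set 1].
  move=> n; have [fA e0 tS] := tP n; have [_ nAx] := xP n.
  have [Psi /tS[S dS <-] Px] := MU_ball_value (t n).2 1 fA e0 nAx.
  by exists S.
have /MUfam_clusterP/(_ B 1 fB ltr01)[Psi [+ [n _ eqn]]] :=
  tauW S (fun n => (SP n).1).
rewrite -{Psi}eqn => b0; have [Bx _] := xP n; have [_ S1] := SP n.
have [_] := b0 _ Bx; rewrite S1 => /(_ 1 erefl)[_ -> ].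
by rewrite subr0 normr1 ltxx.
Qed.

End Family.

(** * Finite sets and compact sets *)

Section FiniteCompactFamilies.
Variable X : topologicalType.
Local Notation finite_fam := (@nonempty_finite X).
Local Notation compact_fam := (@nonempty_compact X).

Lemma countable_cofinal_finite : [set: X] !=set0 ->
  countable [set: X] <-> countably_cofinal finite_fam.
Proof.
move=> [x0 _]; split=> [/countable_injP[f finj]|[A famA cof]].
  exists (fun n => x0 |` f @^-1` `I_n.+1) => [n|B [_ /finite_seqP[D ->]]].
    split; first by exists x0; left.
    rewrite finite_setU; split; first exact: finite_set1.
    apply: finite_preimage; last exact: finite_II.
    by move=> x y _ _; apply: finj; exact: mem_set.
  exists (\max_(x <- D) f x) => x Dx; right.
  by rewrite /= ltnS; exact: leq_bigmax_seq.
apply: (@sub_countable _ _ _ (\bigcup_n A n)).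
  apply: subset_card_le => x _; have [|n xA] := cof [set x].
    by split; [exists x|exact: finite_set1].
  by exists n => //; exact: xA.
apply: bigcup_countable => // n _.
by apply: finite_set_countable; have [] := famA n.
Qed.

Lemma hemicompact_cofinal_compact : [set: X] !=set0 ->
  hemicompact X <-> countably_cofinal compact_fam.
Proof.
move=> [x0 _]; split=> [[F [cF Fc cof]]|[A famA cof]].
  have [K0 FK0 _] := cof _ compact0.
  have [g gF] : exists g : nat -> set X, F = range g.
    by have /pfcard_geP[F0|[g]] := cF;
      [rewrite F0 in FK0|exists g; exact/esym/(image_eq g)].
  exists (fun n => x0 |` g n) => [n|B [_ /cof[K + BK]]].
    split; first by exists x0; left.
    by apply: compactU; [exact: compact_set1|apply: Fc; rewrite gF; exists n].
  by rewrite gF => -[n _ gn]; exists n => x /BK; rewrite -gn; right.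
exists (range A); split=> [|_ [n _ <-]|C cC].
- exact: card_image_le.
- by have [] := famA n.
- have [|n CA] := cof (x0 |` C).
    split; first by exists x0; left.
    by apply: compactU => //; exact: compact_set1.
  by exists (A n) => [|x Cx]; [exists n|apply: CA; right].
Qed.

Lemma omega_covers_family : omega_covers X = family_covers finite_fam.
Proof.
by apply/seteqP; split=> U [cU h]; split=> // A; [move=> [? ?]|move=> ? ?];
  exact: h.
Qed.

Lemma k_covers_family : k_covers X = family_covers compact_fam.
Proof.
by apply/seteqP; split=> U [cU h]; split=> // A; [move=> [? ?]|move=> ? ?];
  exact: h.
Qed.

End FiniteCompactFamilies.

Theorem corollary46 (R : realType) :
  (forall X : topologicalType,
     infinite_set [set: X] -> regular_space X -> accessible_space X ->
     [<-> countable [set: X];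
          metrizable R (MUp R X);
          ~ discretely_selective (MUp R X);
          II_mark_G1 (omega_covers X) (omega_covers X);
          II_mark_G1 (clusters_at (MUp_zero R X)) (clusters_at (MUp_zero R X));
          II_mark_G1 (dense_sets (MUp R X)) (clusters_at (MUp_zero R X))])
  /\
  (forall X : topologicalType,
     ~ compact [set: X] -> regular_space X -> accessible_space X ->
     [<-> hemicompact X;
          hemicompact (hyperspace X);
          metrizable R (MUk R X);
          ~ discretely_selective (MUk R X);
          II_mark_G1 (k_covers X) (k_covers X);
          II_mark_G1 (clusters_at (MUk_zero R X)) (clusters_at (MUk_zero R X));
          II_mark_G1 (dense_sets (MUk R X)) (clusters_at (MUk_zero R X))]).
Proof.
split=> X nX regX T1X.
  have X0 : [set: X] !=set0 by apply/set0P/eqP => X0; apply: nX; rewrite X0.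
  have cofE := countable_cofinal_finite X0.
  pose famU := @nonempty_finiteU X.
  have fam1 (x : X) : nonempty_finite [set x] by split;
    [exists x|exact: finite_set1].
  have famC (A : set X) : nonempty_finite A -> compact A.
    by move=> [_ /finite_compact].
  have fam0 (A : set X) : nonempty_finite A -> A !=set0 by case.
  rewrite omega_covers_family; tfae.
  - by move=> /cofE; exact: (cofinal_metrizable R X0 famU fam1).
  - apply: metrizable_not_discretely_selective.
    exact: (@MUfam_zero_not_isolated R X _ X0 famU fam1).
  - move=> nds; apply: (cofinal_mark_covers fam1).
    apply: contrapT => ncof; apply: nds.
    exact: (@not_cofinal_discretely_selective R X _ regX T1X X0 famU fam1 famC).
  - move=> /(mark_covers_cofinal T1X fam1 fam0).
    exact: (cofinal_mark_clusters R X0 famU fam1).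
  - exact: (@mark_clusters_mark_dense R X _ famU).
  - move=> h; apply/cofE; move: h.
    exact: (@mark_dense_cofinal R X _ regX T1X X0 famU fam1 famC).
have X0 : [set: X] !=set0.
  by apply/set0P/eqP => X0; apply: nX; rewrite X0; exact: compact0.
have cofE := hemicompact_cofinal_compact X0.
pose famU := @nonempty_compactU X.
have fam1 (x : X) : nonempty_compact [set x] by split;
  [exists x|exact: compact_set1].
have famC (A : set X) : nonempty_compact A -> compact A by case.
have fam0 (A : set X) : nonempty_compact A -> A !=set0 by case.
rewrite k_covers_family; tfae.
- exact: hemicompact_hyper (regular_accessible_hausdorff regX T1X).
- by move=> /hyper_hemicompact/cofE; exact: (cofinal_metrizable R X0 famU fam1).
- apply: metrizable_not_discretely_selective.
  exact: (@MUfam_zero_not_isolated R X _ X0 famU fam1).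
- move=> nds; apply: (cofinal_mark_covers fam1).
  apply: contrapT => ncof; apply: nds.
  exact: (@not_cofinal_discretely_selective R X _ regX T1X X0 famU fam1 famC).
- move=> /(mark_covers_cofinal T1X fam1 fam0).
  exact: (cofinal_mark_clusters R X0 famU fam1).
- exact: (@mark_clusters_mark_dense R X _ famU).
- move=> h; apply/cofE; move: h.
  exact: (@mark_dense_cofinal R X _ regX T1X X0 famU fam1 famC).
Qed.
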